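(* Let $X$ be a real uniformly convex Banach space and let $C$ be a nonempty compact convex subset of $X$. Let $\{a_n\}_{n\ge 0}$ be a sequence in $[0,1)$ with $\lim_{n\to\infty} a_n = 0$ and $\sum_{n=0}^{\infty} a_n < \infty$, and let $T: C \to C$ be a mapping that is uniformly $L$-Lipschitzian for some constant $L>0$ and nearly nonexpansive with respect to $\{a_n\}$. Let $\{\alpha_n\}_{n \ge 0}$ be a sequence in $(0,1)$, let $x_0 \in C$, and let $\{x_n\}_{n\ge 0}$ be the modified Picard-Mann iteration defined by $$x_{n+1} = T^n y_n, \qquad y_n = (1-\alpha_n) x_n + \alpha_n T^n x_n, \qquad n \ge 0.$$ Then $\{x_n\}$ converges strongly (in norm) to a fixed point of $T$ if and only if $$\liminf_{n\to\infty} d(x_n, F(T)) = 0.$$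
   Context: $F(T) = \{p \in C : Tp = p\}$ denotes the set of fixed points of $T$, and $T^n$ denotes the $n$-th iterate of $T$ (with $T^0$ the identity). For $x \in C$, $d(x, F(T)) = \inf\{d(x,p) : p \in F(T)\}$, where $d(x,p) = \|x-p\|$. A Banach space $X$ is uniformly convex if its modulus of convexity $\delta_X(\varepsilon) = \inf\{1 - \frac{\|x+y\|}{2} : \|x\| \le 1, \|y\| \le 1, \|x-y\| \ge \varepsilon\}$, $\varepsilon\in[0,2]$, satisfies $\delta_X(0)=0$ and $\delta_X(\varepsilon) > 0$ for all $\varepsilon \in (0,2]$. A mapping $T: C \to C$ is uniformly $L$-Lipschitzian, where $L>0$ is a constant, if $\|T^n x - T^n y\| \le L\|x-y\|$ for all $x,y \in C$ and all $n \ge 1$. Given a sequence $\{a_n\}$ in $[0,1)$ with $\lim_{n\to\infty} a_n = 0$, a mapping $T: C \to C$ is nearly nonexpansive with respect to $\{a_n\}$ if $\|T^n x - T^n y\| \le \|x-y\| + a_n$ for all $x,y \in C$ and all $n \ge 1$. *)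

(* Defs.v *)
From HB Require Import structures.
From mathcomp Require Import all_boot all_order all_algebra.
From mathcomp Require Import all_classical all_reals all_analysis.
Import Order.TTheory GRing.Theory Num.Theory.
Import numFieldNormedType.Exports.

Set Implicit Arguments.
Unset Strict Implicit.
Unset Printing Implicit Defensive.

Local Open Scope classical_set_scope.
Local Open Scope ring_scope.

(* Infima are taken in \bar R, so that the infimum of the empty set is +oo. *)
Definition modulus_of_convexity (R : realType) (X : normedModType R) (e : R) :
    \bar R :=
  ereal_inf [set (1 - `|xy.1 + xy.2| / 2)%:E | xy in
    [set xy : X * X | [/\ `|xy.1| <= 1, `|xy.2| <= 1 & e <= `|xy.1 - xy.2|]]].

Definition uniformly_convex (R : realType) (X : normedModType R) : Prop :=
  modulus_of_convexity X 0 = 0%E /\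
  forall e : R, 0 < e <= 2 -> (0 < modulus_of_convexity X e)%E.

(* A self-mapping of C is represented by a map T : X -> X with set_fun C C T;
   the notions below only depend on the restriction of T to C. *)
Definition fixed_points (X : Type) (C : set X) (T : X -> X) : set X :=
  [set p | C p /\ T p = p].

Definition dist_set (R : realType) (X : normedModType R) (x : X) (A : set X) :
    \bar R :=
  ereal_inf [set `|x - p|%:E | p in A].

Definition uniformly_lipschitzian (R : realType) (X : normedModType R)
    (C : set X) (L : R) (T : X -> X) : Prop :=
  forall (n : nat) (x y : X), (1 <= n)%N -> C x -> C y ->
    `|iter n T x - iter n T y| <= L * `|x - y|.

Definition nearly_nonexpansive (R : realType) (X : normedModType R)
    (C : set X) (a : nat -> R) (T : X -> X) : Prop :=
  forall (n : nat) (x y : X), (1 <= n)%N -> C x -> C y ->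
    `|iter n T x - iter n T y| <= `|x - y| + a n.

Fixpoint picard_mann (R : realType) (X : normedModType R) (T : X -> X)
    (alpha : nat -> R) (x0 : X) (n : nat) : X :=
  if n is m.+1 then
    let x := picard_mann T alpha x0 m in
    let y := (1 - alpha m) *: x + alpha m *: iter m T x in
    iter m T y
  else x0.

(* Main.v *)
Require Import Defs.
From HB Require Import structures.
From mathcomp Require Import all_boot all_order all_algebra.
From mathcomp Require Import all_classical all_reals all_analysis.
From mathcomp Require Import lra.
Import Order.TTheory GRing.Theory Num.Theory.
Import numFieldNormedType.Exports.

Set Implicit Arguments.
Unset Strict Implicit.
Unset Printing Implicit Defensive.

(** The orbit is quasi-Fejer monotone with respect to the fixed points of [T]:
    a fixed point [p] of [T] is fixed by every iterate, so one step
    [x_(n+1) = T^n y_n] costs an error [a_n] for the outer iterate and at most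
    another [a_n] for the inner one, convexity of the norm giving
    [|x_(n+1) - p| <= |x_n - p| + 2 a_n] ([picard_mann_quasi_fejer]).

    Since [2 a_n] is summable, an orbit that is once within [e / 2] of a fixed
    point [p], at a time when the remaining errors sum to less than [e / 2],
    stays within [e] of the same [p] forever.  A vanishing lower limit of the
    distances provides such times for every [e]
    ([quasi_fejer_eventually_close]).  Hence the orbit is Cauchy, and its limit
    is adherent to the set of fixed points, which is closed because [T] is
    Lipschitz on the closed set [C] ([quasi_fejer_cvg],
    [lipschitzian_closed_fixed_points]).  If there is no fixed point, all the
    distances are [+oo] and the lower limit does not vanish.

    Conversely, the distance of [x_n] to the fixed points is at most its
    distance to one of them, so it tends to 0 when [x_n] converges to a fixed
    point ([cvg_limn_einf_dist_set]). *)

Local Open Scope classical_set_scope.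
Local Open Scope ring_scope.

(** The lower limit is the supremum of the infima of the tails, so each tail
    has an infimum below [l]. *)
Lemma limn_einf_lt_frequently (R : realType) (u : nat -> \bar R) (l : \bar R)
    (N : nat) :
  (limn_einf u < l)%E -> exists2 n, (N <= n)%N & (u n < l)%E.
Proof.
rewrite limn_einf_lim => ul.
have /ereal_inf_lt[_ [n Nn <-] unl] : (einfs u N < l)%E.
  apply: le_lt_trans ul; apply: lime_ge; first exact: is_cvg_einfs.
  near=> n; apply: nondecreasing_einfs; near: n.
  exact: nbhs_infty_ge.
by exists n.
Unshelve. all: by end_near. Qed.

Lemma dist_set_ge0 (R : realType) (X : normedModType R) (x : X) (A : set X) :
  (0 <= dist_set x A)%E.
Proof. by apply: le_ereal_inf_tmp => _ [p _ <-]; rewrite lee_fin. Qed.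

Lemma dist_set_le (R : realType) (X : normedModType R) (x p : X) (A : set X) :
  A p -> (dist_set x A <= `|x - p|%:E)%E.
Proof. by move=> Ap; apply: ereal_inf_lbound; exists p. Qed.

Lemma dist_set_lt (R : realType) (X : normedModType R) (x : X) (A : set X)
    (e : R) :
  (dist_set x A < e%:E)%E -> exists2 p, A p & `|x - p| < e.
Proof. by move=> /ereal_inf_lt[_ [p Ap <-]]; rewrite lte_fin; exists p. Qed.

(** The distance to [A] is squeezed between 0 and [|x n - p|]. *)
Lemma cvg_limn_einf_dist_set (R : realType) (X : normedModType R)
    (x : nat -> X) (p : X) (A : set X) :
  A p -> x n @[n --> \oo] --> p ->
  limn_einf (fun n => dist_set (x n) A) = 0%E.
Proof.
move=> Ap xp; suff /cvg_limn_einf_sup[] :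
  dist_set (x n) A @[n --> \oo] --> 0%E by [].
apply: (@squeeze_cvge _ _ _ _ (cst 0%E) _ (fun n => `|x n - p|%:E)).
- by apply: nearW => n; rewrite dist_set_ge0 dist_set_le.
- exact: cvg_cst.
- apply: cvg_EFin; first exact: nearW.
  by apply/norm_cvg0P/subr_cvg0.
Qed.

(** The bound is uniform in [m] because a finite sum of nonnegative terms is at
    most the tail of the series, which tends to 0. *)
Lemma summable_tail_lt (R : realType) (b : nat -> R) (e : R) :
  (forall n, 0 <= b n) -> (\sum_(0 <= n <oo) (b n)%:E < +oo)%E -> 0 < e ->
  \forall n \near \oo, forall m, \sum_(n <= k < m) b k < e.
Proof.
move=> b0 bfin e0.
have := nneseries_tail_cvg bfin (fun k _ => b0 k).
move=> /fine_cvgP[tail_fin] /cvgr0_norm_lt /(_ _ e0) tail_lt.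
near=> n => m; rewrite -lte_fin -sumEFin.
apply: (@le_lt_trans _ _ (\sum_(n <= k <oo) (b k)%:E)%E).
  by apply: nneseries_lim_ge => k _ _; rewrite lee_fin.
have fn : (\sum_(n <= k <oo) (b k)%:E)%E \is a fin_num by near: n.
rewrite -(fineK fn) lte_fin; apply: le_lt_trans (ler_norm _) _.
by near: n.
Unshelve. all: by end_near. Qed.

Lemma quasi_fejer_iter (R : realType) (X : normedModType R) (x : nat -> X)
    (p : X) (b : nat -> R) (n m : nat) :
  (forall k, `|x k.+1 - p| <= `|x k - p| + b k) -> (n <= m)%N ->
  `|x m - p| <= `|x n - p| + \sum_(n <= k < m) b k.
Proof.
move=> xb /subnK <-; elim: (m - n)%N => [|d IHd].
  by rewrite big_geq// addr0.
rewrite addSn big_nat_recr ?leq_addl//= addrA.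
by apply: le_trans (xb _) _; rewrite lerD2r.
Qed.

(** The half [e / 2] pays for the distance to [p] at one well-chosen time, the
    other half for all the errors made afterwards.  That a single [p] works for
    a whole tail of the sequence gives both the Cauchy property and the
    adherence of the limit to [F]. *)
Lemma quasi_fejer_eventually_close (R : realType) (X : normedModType R)
    (F : set X) (x : nat -> X) (b : nat -> R) (e : R) :
  (forall n, 0 <= b n) -> (\sum_(0 <= n <oo) (b n)%:E < +oo)%E ->
  (forall p n, F p -> `|x n.+1 - p| <= `|x n - p| + b n) ->
  limn_einf (fun n => dist_set (x n) F) = 0%E -> 0 < e ->
  exists2 p, F p & \forall n \near \oo, `|p - x n| < e.
Proof.
move=> b0 bfin xb liminf0 e0; have e20 : 0 < e / 2 by rewrite divr_gt0.
have [N _ tail_lt] := summable_tail_lt b0 bfin e20.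
have [n Nn /dist_set_lt[p Fp xnp]] : exists2 n, (N <= n)%N &
    (dist_set (x n) F < (e / 2)%:E)%E.
  by apply: limn_einf_lt_frequently; rewrite liminf0 lte_fin.
exists p => //; near=> m.
have nm : (n <= m)%N by near: m; exact: nbhs_infty_ge.
rewrite distrC [ltRHS]splitr.
apply: le_lt_trans (quasi_fejer_iter (fun k => xb p k Fp) nm) _.
by rewrite ltrD// tail_lt.
Unshelve. all: by end_near. Qed.

(** A tail of [x] lies in a ball of radius [e] centred in [F], for every [e]:
    so [x] is Cauchy, and its limit is approximated by these centres. *)
Lemma quasi_fejer_cvg (R : realType) (X : completeNormedModType R)
    (F : set X) (x : nat -> X) (b : nat -> R) :
  closed F ->
  (forall n, 0 <= b n) -> (\sum_(0 <= n <oo) (b n)%:E < +oo)%E ->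
  (forall p n, F p -> `|x n.+1 - p| <= `|x n - p| + b n) ->
  limn_einf (fun n => dist_set (x n) F) = 0%E ->
  exists2 q, F q & x n @[n --> \oo] --> q.
Proof.
move=> clF b0 bfin xb liminf0.
have close (e : R) (e0 : 0 < e) :=
  quasi_fejer_eventually_close b0 bfin xb liminf0 e0.
have /cvg_ex[q xq] : cvgn x.
  apply/cauchy_cvgP/cauchy_exP => e /close[p _ px].
  by exists p; rewrite -ball_normE.
exists q => //; apply: clF => B /nbhs_ballP[e /= e0 eB].
have e20 : 0 < e / 2 by rewrite divr_gt0.
have [p Fp px] := close _ e20.
exists p; split => //; apply: eB.
have /cvgrPdist_lt /(_ _ e20) qx := xq.
have [n [qxn pxn]] := @filter_ex _ _ _ _ (filterI qx px).
rewrite -ball_normE /= [ltRHS]splitr.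
by rewrite (le_lt_trans (ler_distD (x n) _ _))// ltrD// distrC.
Qed.

(** For [q] adherent to the fixed points and a fixed point [p] close to [q],
    [|T q - q| <= |T q - T p| + |p - q| <= (L + 1) |q - p|], which is
    arbitrarily small. *)
Lemma lipschitzian_closed_fixed_points (R : realType) (X : normedModType R)
    (C : set X) (L : R) (T : X -> X) :
  closed C -> 0 < L -> uniformly_lipschitzian C L T ->
  closed (fixed_points C T).
Proof.
move=> clC L0 lipT q clq.
have Cq : C q by apply: clC; apply: closure_subset clq => p [].
split => //; apply/eqP; rewrite -subr_eq0 -normr_le0.
apply/ler_addgt0Pl => e e0; rewrite addr0.
have d0 : 0 < e / (L + 1) by rewrite divr_gt0// addr_gt0.
have [p [[Cp Tp]]] := clq _ (nbhsx_ballx q _ d0).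
rewrite -ball_normE /= ltr_pdivlMr ?addr_gt0// => qp.
have := lipT 1%N q p isT Cq Cp; rewrite /= Tp => Tqp.
have := ler_distD p (T q) q; rewrite (distrC p q); lra.
Qed.

Lemma iter_set_fun (X : Type) (C : set X) (T : X -> X) (n : nat) (x : X) :
  set_fun C C T -> C x -> C (iter n T x).
Proof. by move=> TC Cx; elim: n => //= n; exact: TC. Qed.

Lemma convex_set_comb (R : realType) (X : normedModType R) (C : set X)
    (x y : X) (t : R) :
  convex_set C -> C x -> C y -> 0 < t < 1 -> C ((1 - t) *: x + t *: y).
Proof.
move=> /convex_setW cC Cx Cy /andP[t0 t1].
have := cC y x (mem_set Cy) (mem_set Cx) (Itv01 (ltW t0) (ltW t1)) t0 t1.
by rewrite inE addrC.
Qed.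

(** Near nonexpansiveness constrains the iterates from [n = 1] on; the case
    [n = 0], which occurs in the first step of the iteration, holds because
    [T^0] is the identity and [a 0] is nonnegative. *)
Lemma nearly_nonexpansive_iter_fixed (R : realType) (X : normedModType R)
    (C : set X) (a : nat -> R) (T : X -> X) (n : nat) (x p : X) :
  (forall k, 0 <= a k) -> nearly_nonexpansive C a T -> C x ->
  fixed_points C T p -> `|iter n T x - p| <= `|x - p| + a n.
Proof.
move=> a0 nneT Cx [Cp Tp]; case: n => [|n]; first by rewrite lerDl.
have Tnp : iter n.+1 T p = p by elim: n.+1 => //= m ->.
by have := nneT n.+1 x p isT Cx Cp; rewrite Tnp.
Qed.

Lemma picard_mann_in (R : realType) (X : normedModType R) (C : set X)
    (T : X -> X) (alpha : nat -> R) (x0 : X) (n : nat) :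
  convex_set C -> set_fun C C T -> (forall n, 0 < alpha n < 1) -> C x0 ->
  C (picard_mann T alpha x0 n).
Proof.
move=> cC TC alpha01 Cx0; elim: n => //= n IHn.
apply: (iter_set_fun _ TC); apply: convex_set_comb => //.
exact: iter_set_fun TC IHn.
Qed.

(** One [a n] comes from the outer iterate applied to [y]; the other bounds the
    contribution [alpha n * a n] of the inner iterate to [|y - p|]. *)
Lemma picard_mann_quasi_fejer (R : realType) (X : normedModType R)
    (C : set X) (a : nat -> R) (T : X -> X) (alpha : nat -> R) (x0 p : X)
    (n : nat) :
  convex_set C -> set_fun C C T -> (forall n, 0 <= a n) ->
  nearly_nonexpansive C a T -> (forall n, 0 < alpha n < 1) -> C x0 ->
  fixed_points C T p ->
  `|picard_mann T alpha x0 n.+1 - p| <=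
    `|picard_mann T alpha x0 n - p| + (a n + a n).
Proof.
move=> cC TC a0 nneT alpha01 Cx0 Fp /=.
have := picard_mann_in n cC TC alpha01 Cx0.
set x := picard_mann _ _ _ n => Cx.
have [al0 al1] := andP (alpha01 n).
set y := (1 - alpha n) *: x + _.
have Cy : C y by apply: convex_set_comb => //; exact: iter_set_fun TC Cx.
apply: le_trans (nearly_nonexpansive_iter_fixed n a0 nneT Cy Fp) _.
rewrite addrA lerD2r.
have -> : y - p = (1 - alpha n) *: (x - p) + alpha n *: (iter n T x - p).
  by rewrite !scalerBr addrACA -opprD -scalerDl subrK scale1r.
apply: le_trans (ler_normD _ _) _; rewrite !normrZ gtr0_norm ?subr_gt0//.
rewrite (gtr0_norm al0).
have Tx := nearly_nonexpansive_iter_fixed n a0 nneT Cx Fp.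
have := ler_wpM2l (ltW al0) Tx.
have : alpha n * a n <= a n by rewrite ler_piMl// ltW.
lra.
Qed.

Theorem theorem3p2 (R : realType) (X : completeNormedModType R)
    (X_uc : uniformly_convex X)
    (C : set X) (C_neq0 : C !=set0) (C_compact : compact C)
    (C_convex : convex_set C)
    (a : nat -> R) (a_bounds : forall n, 0 <= a n < 1)
    (a_cvg0 : a n @[n --> \oo] --> (0 : R))
    (a_summable : (\sum_(0 <= n <oo) (a n)%:E < +oo)%E)
    (T : X -> X) (T_self : set_fun C C T)
    (L : R) (L_gt0 : 0 < L) (T_lip : uniformly_lipschitzian C L T)
    (T_nne : nearly_nonexpansive C a T)
    (alpha : nat -> R) (alpha_bounds : forall n, 0 < alpha n < 1)
    (x0 : X) (Cx0 : C x0) :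
  let x := picard_mann T alpha x0 in
  (exists2 p, fixed_points C T p & x n @[n --> \oo] --> p) <->
  limn_einf (fun n => dist_set (x n) (fixed_points C T)) = 0%E.
Proof.
move=> x; have a0 n : 0 <= a n by case/andP: (a_bounds n).
split=> [[p Fp xp]|]; first exact: cvg_limn_einf_dist_set Fp xp.
have closedC : closed C by apply: compact_closed => //; exact: norm_hausdorff.
apply: (@quasi_fejer_cvg _ _ _ _ (fun n => a n + a n)).
- exact: lipschitzian_closed_fixed_points closedC L_gt0 T_lip.
- by move=> n; rewrite addr_ge0.
- under eq_eseriesr do rewrite EFinD.
  by rewrite nneseriesD ?lte_add_pinfty// => n _ _; rewrite lee_fin.
- by move=> p n Fp; exact: (picard_mann_quasi_fejer n C_convex).
Qed.
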